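(* Let $d$, $i$, $k$ be integers with $1\le i<d-1$ and $1<k<d$. Set $$f^\star=\binom{d}{k}\sum_{j=l}^{u}2^{d-j}\,\frac{\binom{d-k}{j}\binom{k}{i-j}}{\binom{d-i}{d-k-j}},\qquad l=\max\{0,i-k+1\},\quad u=\min\{i-1,d-k-1\}.$$ Then the number $f_i(\rho_{d,k})$ of $i$-dimensional faces of $\rho_{d,k}$ satisfies: (i) $f_i(\rho_{d,k})=f^\star$ when $i\ge\max\{d-k,k-1\}$; (ii) $f_i(\rho_{d,k})=2^{i+1}\binom{d}{i+1}+f^\star$ when $d-k\le i<k-1$; (iii) $f_i(\rho_{d,k})=2^{d-i}\binom{d}{i}+f^\star$ when $k-1\le i<d-k$; (iv) $f_i(\rho_{d,k})=2^{i+1}\binom{d}{i+1}+2^{d-i}\binom{d}{i}+f^\star$ when $i<\min\{d-k,k-1\}$.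
   Context: $\gamma_d=[-1,1]^d\subset\mathbb{R}^d$ is the hypercube, and $\beta_d=\mathrm{conv}\{\pm e_1,\dots,\pm e_d\}$ is the cross-polytope whose vertices are the centers of the facets of $\gamma_d$. For $k\in[1,d]$, $\rho_{d,k}=\mathrm{conv}\left(\beta_d\cup\frac{1}{k}\gamma_d\right)$. For a polytope $P$, $f_i(P)$ is the number of its $i$-dimensional faces. A sum over an empty range is $0$. *)

(* Defs.v *)
From mathcomp Require Import all_boot all_order all_algebra finmap.
From mathcomp Require Import boolp classical_sets functions cardinality reals.
From mathcomp Require Import convex.

Set Implicit Arguments.
Unset Strict Implicit.
Unset Printing Implicit Defensive.

Import Order.TTheory GRing.Theory Num.Theory.
Local Open Scope classical_set_scope.
Local Open Scope ring_scope.

Section Polytopes.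
Context {R : realType} {d : nat}.
Notation E := 'rV[R]_d.
Implicit Types (A P F : set E) (n i : nat).

Definition conv_hull A : set E := smallest (@convex_set R E) A.

Definition affine_hull A : set E :=
  [set x | exists n (p : 'I_n -> E) (a : 'I_n -> R),
     [/\ forall j, A (p j), \sum_j a j = 1 & x = \sum_j a j *: p j]].

(* This is a relation because the empty set has no dimension in nat. *)
Definition has_dim A n : Prop :=
  exists (x : E) (V : {vspace E}),
    affine_hull A = [set x + v | v in [set v : E | v \in V]] /\ \dim V = n.

Definition dot (c x : E) : R := \sum_j c 0 j * x 0 j.

(* Taking c = 0, both P itself and the empty set are faces of P. *)
Definition is_face P F : Prop :=
  exists (c : E) (m : R),
    (forall x, P x -> dot c x <= m) /\ F = P `&` [set x | dot c x = m].

Definition faces i P : set (set E) := [set F | is_face P F /\ has_dim F i].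

(* Only meaningful when [faces i P] is finite: [fset_set] sends an infinite
   set to the empty one. *)
Definition num_faces i P : nat := #|` fset_set (faces i P)|.

End Polytopes.

Section Rho.
Context (R : realType) (d : nat).

Definition hypercube : set 'rV[R]_d := [set x | forall j, -1 <= x 0 j <= 1].

Definition cross_polytope : set 'rV[R]_d :=
  conv_hull [set x | exists j, x = delta_mx 0 j \/ x = - delta_mx 0 j].

Definition rho (k : R) : set 'rV[R]_d :=
  conv_hull (cross_polytope `|` [set k^-1 *: x | x in hypercube]).

End Rho.

Arguments rho {R} d k _.

(* The subtractions are in nat: the lower bound [i + 1 - k] truncates to
   max (0, i - k + 1), and no other difference is negative when 1 <= i < d - 1,
   1 < k < d and j is in the range. The upper bound of the sum is exclusive. *)
Definition fstar (d k i : nat) : rat :=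
  'C(d, k)%:R *
  \sum_(i + 1 - k <= j < (minn (i - 1) (d - k - 1)).+1)
     2 ^+ (d - j) * (('C(d - k, j)%:R * 'C(k, i - j)%:R)
                     / 'C(d - i, d - k - j)%:R).

(* Main.v *)
Require Import Defs.
From mathcomp Require Import boolp classical_sets cardinality reals.
From mathcomp Require Import convex interval_inference.
(* Imported after classical_sets: the lemma names shared by the two set
   libraries must denote those of finset. *)
From mathcomp Require Import all_boot all_order all_algebra finmap.
From mathcomp Require Import zify ring lra.

(** [rho d k] is the convex hull of the points [+-e_j] and [u / k], [u] a sign
vector, on which a linear functional [c] takes the maximal values [max_j |c_j|]
and [(sum_j |c_j|) / k]. Hence the face exposed by a nonzero [c] depends only on
the signs of [c], on the set [T] of coordinates of maximal absolute value and
on the set [N] of nonzero coordinates. With [t = #|T|] and [n = #|N|], the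
faces are
- simplices of dimension [t - 1], when the first maximum is the larger one;
  then only the signs on [T] matter and [1 <= t < k];
- cubes ([t = 0]) and mixed faces ([t > 0]) of dimension [d - n + t], when the
  second one is the larger, respectively when there is a tie; then [t < k < n];
- facets, for a tie with [T = N] and [t = n = k].
Choosing [N], then [T] in [N], then the signs, there are
[2^n 'C(d, n) 'C(n, t)] faces with given [n] and [t]; those of dimension [i]
have [n = d - j] and [t = i - j] for some [j], and [j = i] gives the cubes. *)

Set Implicit Arguments.
Unset Strict Implicit.
Unset Printing Implicit Defensive.

Import Order.TTheory GRing.Theory Num.Theory.
Local Open Scope ring_scope.

(** * Convex hulls of finite families, and their faces and dimension *)

Section ConvexHull.
Local Open Scope classical_set_scope.
Context {R : realType} {d : nat}.
Local Notation E := 'rV[R]_d.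
Implicit Types (A : set E) (c x y : E).

Lemma convex_setP A :
  @convex_set R E A <->
  forall x y (t : R), 0 <= t <= 1 -> A x -> A y -> A (t *: x + (1 - t) *: y).
Proof.
split=> [cA x y t /andP[t0 t1] Ax Ay|cA x y t xA yA].
  have := cA x y (Itv01 t0 t1) (mem_set Ax) (mem_set Ay).
  by rewrite classical_sets.in_setE.
apply/mem_set; apply: cA; [|exact: set_mem xA|exact: set_mem yA].
by rewrite ge0/= le1.
Qed.

Lemma convex_conv_hull A : @convex_set R E (conv_hull A).
Proof.
apply/convex_setP => x y t t01 hx hy B [cB AB].
by have /convex_setP := cB; apply=> //; [apply: hx|apply: hy].
Qed.

Lemma dot_suml (I : finType) c (a : I -> R) (q : I -> E) :
  dot c (\sum_i a i *: q i) = \sum_i a i * dot c (q i).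
Proof.
rewrite /dot; under [RHS]eq_bigr do rewrite mulr_sumr.
rewrite exchange_big/=; apply: eq_bigr => j _.
rewrite summxE mulr_sumr; apply: eq_bigr => i _; rewrite mxE; ring.
Qed.

Section Hull.
Context {V : finType} (p : V -> E).
Implicit Types (S : {set V}) (a : V -> R).

(** The weights are indexed by all of [V] and vanish off [S], so that passing to a face changes [S]
    but keeps the weights. *)
Definition hull S : set E :=
  [set x | exists a : V -> R,
     [/\ forall v, 0 <= a v, forall v, v \notin S -> a v = 0,
         \sum_v a v = 1 & x = \sum_v a v *: p v]].

Lemma hull_vertex S v : v \in S -> hull S (p v).
Proof.
move=> vS; exists (fun u => (u == v)%:R); split=> [u|u uS||].
- exact: ler0n.
- by case: eqP => // uv; rewrite uv vS in uS.
- by rewrite (bigD1 v)//= eqxx big1 ?addr0// => u /negPf->.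
- rewrite (bigD1 v)//= eqxx scale1r big1 ?addr0// => u /negPf->.
  by rewrite scale0r.
Qed.

Lemma convex_hull S : @convex_set R E (hull S).
Proof.
apply/convex_setP => x y t /andP[t0 t1] [a [a0 aS a1 ->]] [b [b0 bS b1 ->]].
exists (fun v => t * a v + (1 - t) * b v); split=> [v|v vS||].
- by rewrite addr_ge0// mulr_ge0// subr_ge0.
- by rewrite aS// bS// !mulr0 addr0.
- rewrite big_split/= -!mulr_sumr a1 b1 !mulr1; ring.
- rewrite !scaler_sumr -big_split/=; apply: eq_bigr => v _.
  by rewrite [RHS]scalerDl !scalerA.
Qed.

(* The point [x] carries the weight not used by [s]: this is what makes the
   induction on [s] work without renormalizing the weights. *)
Lemma convex_combination A a x (s : seq V) :
  @convex_set R E A -> (forall v, 0 <= a v) -> (forall v, A (p v)) ->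
  A x -> \sum_(v <- s) a v <= 1 ->
  A ((1 - \sum_(v <- s) a v) *: x + \sum_(v <- s) a v *: p v).
Proof.
move=> /convex_setP cA a0 Ap; elim: s x => [|v s IH] x Ax.
  by move=> _; rewrite !big_nil subr0 scale1r addr0.
rewrite !big_cons; set sg := \sum_(j <- s) a j => le1.
have b0 : a v <= 1 - sg by lra.
have av := a0 v.
(* If [1 - sg] is 0, division gives [t = 0]; this is consistent, [a v] being squeezed between 0 and
   [1 - sg]. *)
pose t := a v / (1 - sg).
have tb : t * (1 - sg) = a v.
  have [sg1|sg1] := eqVneq (1 - sg) 0; last by rewrite divfK.
  by rewrite sg1 mulr0; lra.
have := IH (t *: p v + (1 - t) *: x) _ _.
rewrite -/sg => h; have -> : (1 - (a v + sg)) *: x +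
    (a v *: p v + \sum_(j <- s) a j *: p j) =
  (1 - sg) *: (t *: p v + (1 - t) *: x) + \sum_(v0 <- s) a v0 *: p v0.
  rewrite scalerDr !scalerA [(1 - sg) * t]mulrC tb mulrBr [_ * t]mulrC tb mulr1.
  by rewrite addrA; congr (_ + _); rewrite addrC; congr (_ + _ *: _); ring.
apply: h; last by lra.
apply: cA => //; apply/andP; split; first by rewrite divr_ge0// (le_trans av).
have [sg1|sg1] := eqVneq (1 - sg) 0; first by rewrite /t sg1 invr0 mulr0 ler01.
by rewrite ler_pdivrMr ?mul1r// lt_neqAle eq_sym sg1 (le_trans av).
Qed.

Lemma hull_min A S :
  @convex_set R E A -> (forall v, A (p v)) -> hull S `<=` A.
Proof.
move=> cA Ap x [a [a0 _ a1 ->]].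
(* Any [v] serves as the starting point, since the weight left to it is 1 - 1 = 0. *)
have [v _|V0] := pickP (@predT V); last first.
  by move: a1; rewrite big_pred0// => /eqP; rewrite eq_sym oner_eq0.
have := @convex_combination A a (p v) (index_enum V) cA a0 Ap (Ap v).
by rewrite a1 subrr scale0r add0r; apply.
Qed.

Lemma hull_subspace S x0 (W : {vspace E}) :
  (forall v, v \in S -> p v - x0 \in W) ->
  forall x, hull S x -> x - x0 \in W.
Proof.
move=> SW x [a [a0 aS a1 ->]].
have -> : \sum_v a v *: p v - x0 = \sum_v a v *: (p v - x0).
  under [RHS]eq_bigr do rewrite scalerBr.
  by rewrite sumrB -scaler_suml a1 scale1r.
apply: memv_suml => v _; have [vS|vS] := boolP (v \in S).
  by apply: memvZ; apply: SW.
by rewrite aS// scale0r mem0v.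
Qed.

Lemma dot_hull_le c m S x :
  (forall v, dot c (p v) <= m) -> hull S x -> dot c x <= m.
Proof.
move=> cm [a [a0 _ a1 ->]]; rewrite dot_suml -[m]mul1r -a1 mulr_suml.
by apply: ler_sum => v _; apply: ler_wpM2l.
Qed.

(** When a weighted mean of the [dot c (p v)] reaches their bound [m], the nonnegative terms
    [a v * (m - dot c (p v))] add up to 0, so no weight lies off the tight vertices. *)
Lemma hull_face c m : (forall v, dot c (p v) <= m) ->
  hull [set: V]%SET `&` [set x | dot c x = m] =
  hull [set v | dot c (p v) == m]%SET.
Proof.
move=> cm; apply/seteqP; split=> x /=.
  move=> [[a [a0 _ a1 ->]]]; rewrite dot_suml => eqm.
  exists a; split=> // v; rewrite inE => ne.
  have : \sum_v a v * (m - dot c (p v)) = 0.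
    under eq_bigr do rewrite mulrBr.
    by rewrite sumrB -mulr_suml a1 eqm mul1r subrr.
  move/eqP; rewrite psumr_eq0; last first.
    by move=> u _; rewrite mulr_ge0// subr_ge0.
  move=> /allP /(_ v (mem_index_enum _)) /=.
  by rewrite mulf_eq0 subr_eq0 [m == _]eq_sym (negPf ne) orbF => /eqP.
move=> [a [a0 aS a1 ->]]; split.
  by exists a; split=> // v; rewrite inE.
rewrite dot_suml -[RHS]mul1r -a1 mulr_suml; apply: eq_bigr => v _.
have [/eqP->//|ne] := boolP (dot c (p v) == m).
by rewrite aS ?mul0r// inE.
Qed.

(** An exposed face thus determines its set of tight vertices, which later separates the faces of
    distinct codes. *)
Lemma hull_face_vertex c m v : (forall v, dot c (p v) <= m) ->
  hull [set v | dot c (p v) == m]%SET (p v) <-> dot c (p v) == m.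
Proof.
move=> cm; split=> [|e]; last by apply: hull_vertex; rewrite inE.
by rewrite -hull_face// => -[_ /eqP].
Qed.

End Hull.

Lemma affine_hull_sub A (x0 : E) (W : {vspace E}) :
  (forall x, A x -> x - x0 \in W) ->
  forall x, affine_hull A x -> x - x0 \in W.
Proof.
move=> AW x [n [q [a [Aq a1 ->]]]].
have -> : \sum_j a j *: q j - x0 = \sum_j a j *: (q j - x0).
  under [RHS]eq_bigr do rewrite scalerBr.
  by rewrite sumrB -scaler_suml a1 scale1r.
by apply: memv_suml => j _; apply: memvZ; apply: AW.
Qed.

Lemma sub_affine_hull A x : A x -> affine_hull A x.
Proof.
move=> Ax; exists 1%N, (fun=> x), (fun=> 1); split=> //.
  by rewrite big_ord1.
by rewrite big_ord1 scale1r.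
Qed.

(** The differences of points of an affine subspace recover its direction space, whatever the base
    point. *)
Lemma has_dim_inj A m n : has_dim A m -> has_dim A n -> m = n.
Proof.
move=> [x [V [AV <-]]] [y [W [AW <-]]]; have VW := etrans (esym AV) AW.
suff key : forall x y (V W : {vspace E}),
    [set x + v | v in [set v | v \in V]] =
    [set y + v | v in [set v | v \in W]] -> (V <= W)%VS.
  by congr (\dim _); apply/eqP; rewrite eqEsubv (key x y)//= (key y x).
move=> {}x {}y {AV VW}V {AW}W e; apply/subvP => v vV.
have inW u : u \in V -> x + u - y \in W.
  move=> uV; have : [set x + v | v in [set v | v \in V]] (x + u) by exists u.
  by rewrite e => -[w /= wW <-]; rewrite addrC addKr.
have -> : v = (x + v - y) - (x + 0 - y).
  by rewrite addr0 opprB addrA subrK addrC addKr.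
by rewrite rpredB// inW// mem0v.
Qed.

Lemma has_dim_nonempty A n : has_dim A n -> exists x, A x.
Proof.
move=> [x [V [AV _]]].
have : affine_hull A x by rewrite AV; exists 0; rewrite /= ?mem0v ?addr0.
case=> -[|m] [q [a [Aq a1 _]]]; last by exists (q ord0).
by move: a1; rewrite big_ord0 => /eqP; rewrite eq_sym oner_eq0.
Qed.

(** * Dimension from an independent family of directions *)

Section Frame.
Context (I : {set 'I_d}) (x0 : E) (b : 'I_d -> E).
Context (indep : forall a : 'I_d -> R,
  \sum_(j in I) a j *: b j = 0 -> forall j, j \in I -> a j = 0).

Definition frame : seq E := [tuple b (enum_val i) | i < #|I|].

Lemma mem_frame j : j \in I -> b j \in frame.
Proof.
move=> jI; apply/(@tnthP _ _ [tuple b (enum_val i) | i < #|I|]).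
by exists (enum_rank_in jI j); rewrite tnth_mktuple enum_rankK_in.
Qed.

Lemma dim_frame : \dim <<frame>> = #|I|.
Proof.
suff fr : free frame by rewrite (eqP fr) size_tuple.
apply/freeP => k k0 i.
(* [a] carries the coefficients from ranks back to coordinates, with a default value off [I]. *)
pose a j := k (enum_rank_in (enum_valP i) j).
have aE l : a (enum_val l) = k l by rewrite /a enum_valK_in.
rewrite -aE; apply: (indep _ (enum_valP i)).
rewrite big_enum_val -[RHS]k0; apply: eq_bigr => l _.
by rewrite aE -tnth_nth tnth_mktuple.
Qed.

Lemma has_dim_frame A : A x0 -> (forall j, j \in I -> A (x0 + b j)) ->
  (forall x, A x -> x - x0 \in <<frame>>%VS) -> has_dim A #|I|.
Proof.
move=> Ax0 Ab AV; exists x0, <<frame>>%VS; split; last exact: dim_frame.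
apply/seteqP; split=> x.
  move=> /(affine_hull_sub AV) xV; exists (x - x0) => //=.
  by rewrite addrC subrK.
move=> [v /= /coord_span vE <-].
(* [None] indexes [x0], whose coefficient completes those of the frame to 1. *)
pose q (i : option 'I_#|I|) : E := oapp (fun i => x0 + b (enum_val i)) x0 i.
pose k (i : 'I_#|I|) : R := coord [tuple b (enum_val i) | i < #|I|] i v.
pose a (i : option 'I_#|I|) := oapp k (1 - \sum_i k i) i.
have so (W : nmodType) (G : option 'I_#|I| -> W) :
  \sum_(i < #|{: option 'I_#|I|}|) G (enum_val i) = G None + \sum_i G (Some i).
  rewrite -(big_enum_val (A := predT)) (bigD1 None)//=; congr (_ + _).
  rewrite (reindex_omap Some id) => [|[]]//=.
  by apply: eq_bigl => i; rewrite eqxx.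
exists #|{: option 'I_#|I|}|, (q \o enum_val), (a \o enum_val); split.
- move=> j /=; case: (enum_val j) => //= i.
  by apply: Ab; apply: enum_valP.
- by rewrite /= so /= subrK.
- rewrite /= (so _ (fun i => a i *: q i)) /=.
  rewrite [X in _ = _ + X](eq_bigr (fun i =>
    k i *: x0 + k i *: b (enum_val i))); last by move=> i _; rewrite -scalerDr.
  rewrite big_split/= addrA -scaler_suml -scalerDl subrK scale1r.
  congr (_ + _); rewrite [LHS]vE; apply: eq_bigr => i _.
  by rewrite -tnth_nth tnth_mktuple.
Qed.

Lemma leq_has_dim A n : has_dim A n -> A x0 ->
  (forall j, j \in I -> A (x0 + b j)) -> (#|I| <= n)%N.
Proof.
move=> [x [V [AV <-]]] Ax0 Ab; rewrite -dim_frame; apply: dimvS.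
have inV y : A y -> y - x \in V.
  by move=> /sub_affine_hull; rewrite AV => -[v /= vV <-]; rewrite addrC addKr.
apply/span_subvP => _ /(@tnthP _ _ [tuple b (enum_val i) | i < #|I|])[i ->].
rewrite tnth_mktuple.
have -> : b (enum_val i) = (x0 + b (enum_val i) - x) - (x0 - x).
  by rewrite opprB addrA subrK addrC addKr.
by apply: rpredB; apply: inV => //; apply: Ab; apply: enum_valP.
Qed.

End Frame.
End ConvexHull.

(** * Vertices *)

Section RhoVertices.
Local Open Scope classical_set_scope.
Context {R : realType} {d : nat} (k : nat).
Context (k_gt0 : (0 < k)%N).
Local Notation E := 'rV[R]_d.
Implicit Types (c x : E).

Definition vertex : finType := ('I_d * bool + {ffun 'I_d -> bool})%type.

Definition vertex_pt (v : vertex) : E :=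
  match v with
  | inl (j, b) => (-1) ^+ b *: delta_mx 0 j
  | inr u => k%:R^-1 *: \row_j (-1) ^+ u j
  end.

Local Notation pt := vertex_pt.

Let k0 : 0 < k%:R :> R. Proof. by rewrite ltr0n. Qed.

Lemma hypercube_hull x :
  hypercube x -> hull pt [set: vertex]%SET (k%:R^-1 *: x).
Proof.
move=> x1; pose g (j : 'I_d) (b : bool) : R := (1 + (-1) ^+ b * x 0 j) / 2.
pose a (v : vertex) : R := if v is inr u then \prod_j g j (u j) else 0.
have sumg j : \sum_b g j b = 1 by rewrite big_bool /g /= expr0 expr1; field.
have distr (F : 'I_d -> bool -> R) :
  \sum_(u : {ffun 'I_d -> bool}) \prod_j F j (u j) = \prod_j \sum_b F j b.
  by rewrite bigA_distr_bigA.
(* The weights are those of a product measure with mean [x]. *)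
exists a; split=> [[//|u]|v||].
- apply: prodr_ge0 => j _; rewrite /g divr_ge0//.
  by case: (u j) (x1 j) => /andP[]; rewrite /= ?expr0 ?expr1; lra.
- by rewrite inE.
- rewrite big_sumType/= big1// add0r distr big1// => j _.
- rewrite big_sumType/= big1 ?add0r => [|v _]; last by rewrite scale0r.
  apply/rowP => l; rewrite !mxE summxE.
  under eq_bigr do rewrite !mxE mulrCA.
  rewrite -mulr_sumr; congr (_ * _).
  (* With the sign inserted as a factor at [l] alone, the mean of coordinate [l] is again a sum of
     products, and distributivity applies. *)
  pose h j b := g j b * (if j == l then (-1) ^+ b else 1).
  rewrite (eq_bigr (fun u : {ffun 'I_d -> bool} => \prod_j h j (u j))).
    rewrite distr (bigD1 l)//= [X in _ * X]big1 ?mulr1 => [|j jl].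
      by rewrite big_bool /h /g /= eqxx expr0 expr1; field.
    rewrite -[RHS](sumg j); apply: eq_bigr => b _.
    by rewrite /h (negPf jl) mulr1.
  move=> u _; rewrite /h [RHS]big_split/=; congr (_ * _).
  by rewrite -big_mkcond/= big_pred1_eq.
Qed.

Lemma rho_hull : rho d k%:R = hull pt [set: vertex]%SET.
Proof.
apply/seteqP; split.
  apply: smallest_sub; first exact: convex_hull.
  move=> x [|[y y1 <-]]; last exact: hypercube_hull.
  apply: smallest_sub => {x}; first exact: convex_hull.
  move=> _ [j [->|->]].
    have -> : delta_mx 0 j = pt (inl (j, false)) by rewrite /= scale1r.
    by apply: hull_vertex; rewrite inE.
  have -> : - delta_mx 0 j = pt (inl (j, true)) by rewrite /= expr1 scaleN1r.
  by apply: hull_vertex; rewrite inE.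
apply: hull_min; first exact: convex_conv_hull.
move=> [[j b]|u]; apply: sub_gen_smallest.
  left; apply: sub_gen_smallest; exists j.
  by case: b; [right; rewrite /= expr1 scaleN1r|left; rewrite /= scale1r].
right; exists (\row_j (-1) ^+ u j) => // j; rewrite mxE.
by case: (u j); rewrite /= ?expr0 ?expr1; lra.
Qed.

Lemma dot_inl c j b : dot c (pt (inl (j, b))) = (-1) ^+ b * c 0 j.
Proof.
rewrite /dot (bigD1 j)//= !mxE !eqxx mulr1 big1 ?addr0 1?mulrC// => l lj.
by rewrite !mxE (negPf lj) !mulr0.
Qed.

Lemma dot_inr c u :
  dot c (pt (inr u)) = k%:R^-1 * \sum_j (-1) ^+ u j * c 0 j.
Proof.
by rewrite /dot mulr_sumr; apply: eq_bigr => j _; rewrite !mxE; ring.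
Qed.

Definition norm1 c : R := \sum_j `|c 0 j|.

Lemma sign_mul_le (z : R) b : (-1) ^+ b * z <= `|z|.
Proof. by rewrite (le_trans (ler_norm _))// normrM normr_sign mul1r. Qed.

(** Both signs attain the bound at 0: this leaves the cube vertices of a face free outside the
    support. *)
Lemma sign_mul_eq (z : R) (b : bool) :
  ((-1) ^+ b * z == `|z|) = (z != 0) ==> (b == (z < 0)).
Proof.
have [->|z0] := eqVneq z 0; first by rewrite mulr0 normr0 !eqxx.
rewrite /=; case: (ltrgtP z 0) z0 => // zs _; case: b; rewrite ?expr0 ?expr1.
- by rewrite ltr0_norm// mulN1r !eqxx.
- by rewrite ltr0_norm// mul1r; apply/negbTE/eqP => ?; lra.
- by rewrite gtr0_norm// mulN1r; apply/negbTE/eqP => ?; lra.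
- by rewrite gtr0_norm// mul1r !eqxx.
Qed.

Lemma vertex_le c m : (forall j, `|c 0 j| <= m) -> norm1 c <= k%:R * m ->
  forall v, dot c (pt v) <= m.
Proof.
move=> cm c1 [[j b]|u]; first by rewrite dot_inl (le_trans (sign_mul_le _ _)).
rewrite dot_inr mulrC ler_pdivrMr// mulrC (le_trans _ c1)//.
by apply: ler_sum => j _; apply: sign_mul_le.
Qed.

(** Each bound is read off at a vertex whose signs are those of [c]. *)
Lemma le_vertex c m : (forall v, dot c (pt v) <= m) ->
  (forall j, `|c 0 j| <= m) /\ norm1 c <= k%:R * m.
Proof.
move=> cm; split=> [j|].
  have := cm (inl (j, c 0 j < 0)); rewrite dot_inl; congr (_ <= _).
  by apply/eqP; rewrite sign_mul_eq eqxx implybT.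
have := cm (inr [ffun j => c 0 j < 0]).
rewrite dot_inr mulrC ler_pdivrMr// mulrC; congr (_ <= _).
apply: eq_bigr => j _; rewrite ffunE.
by apply/eqP; rewrite sign_mul_eq eqxx implybT.
Qed.

(** As [m] is positive, a coordinate of modulus [m] is nonzero, so at most one of two opposite
    vertices is tight. *)
Lemma tight_inl c m j b : 0 < m -> `|c 0 j| <= m ->
  (dot c (pt (inl (j, b))) == m) = (`|c 0 j| == m) && (b == (c 0 j < 0)).
Proof.
move=> m0 cm; rewrite dot_inl.
have [e|ne] := eqVneq `|c 0 j| m; last first.
  by rewrite lt_eqF// (le_lt_trans (sign_mul_le _ _))// lt_neqAle ne.
rewrite -[X in _ == X]e sign_mul_eq.
by have -> : c 0 j != 0 by rewrite -normr_gt0 e.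
Qed.

Lemma tight_inr c m u : norm1 c <= k%:R * m ->
  (dot c (pt (inr u)) == m) =
  (norm1 c == k%:R * m) && [forall j, (c 0 j != 0) ==> (u j == (c 0 j < 0))].
Proof.
move=> cm; rewrite dot_inr.
rewrite -(inj_eq (mulfI (lt0r_neq0 k0))) mulVKf ?lt0r_neq0//.
have le : \sum_j (-1) ^+ u j * c 0 j <= norm1 c.
  by apply: ler_sum => j _; apply: sign_mul_le.
have [e|ne] := eqVneq (norm1 c) (k%:R * m); last first.
  by rewrite lt_eqF// (le_lt_trans le)// lt_neqAle ne.
rewrite -e eq_sym -subr_eq0 -sumrB psumr_eq0 => [|j _]; last first.
  by rewrite subr_ge0 sign_mul_le.
apply/allP/forallP => [h j|h j _ /=]; last first.
  by rewrite subr_eq0 eq_sym sign_mul_eq.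
by have := h j (mem_index_enum _); rewrite /= subr_eq0 eq_sym sign_mul_eq.
Qed.

End RhoVertices.

(** * Combinatorial codes of the faces *)

Section Codes.
Local Open Scope set_scope.
Context {d : nat} (k : nat).

(* [None] stands for a coordinate outside [N], and [Some (b, t)] for one in [N]
   of sign [(-1) ^+ b], which is in [T] when [t]; thus [supp w] is [N] and
   [top w] is [T]. The code of a simplex has [N = T], whatever the support of
   the functionals exposing it. *)
Definition code := {ffun 'I_d -> option (bool * bool)}.
Implicit Types w : code.

Definition supp w : {set 'I_d} := [set j | isSome (w j)]%SET.
Definition top w : {set 'I_d} := [set j | oapp snd false (w j)]%SET.
Definition neg w (j : 'I_d) : bool := oapp fst false (w j).

Lemma top_sub_supp w : top w \subset supp w.
Proof. by apply/subsetP => j; rewrite !inE; case: (w j). Qed.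

Lemma code_eq w w' : supp w = supp w' -> top w = top w' ->
  {in supp w, neg w =1 neg w'} -> w = w'.
Proof.
move=> /setP es /setP et en; apply/ffunP => j.
move: (es j) (et j) (en j); rewrite !inE /neg.
by case: (w j) (w' j) => [[b t]|] [[b' t']|]//= _ -> /(_ isT) ->.
Qed.

(** The test [k <= #|supp w|] keeps cube vertices out of the simplices. *)
Definition code_vertices w : {set vertex} :=
  [set v : @vertex d | match v with
           | inl (j, b) => (j \in top w) && (b == neg w j)
           | inr u => (k <= #|supp w|)%N &&
                      [forall j, (j \in supp w) ==> (u j == neg w j)]
           end]%SET.

(** For [i] off the support, the vertices of [base w] and [flip w i] differ by [2 / k] times the
    [i]-th unit vector: the pair shows that coordinate [i] is free and yields a direction of the
    face. *)
Definition base w : {ffun 'I_d -> bool} :=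
  [ffun j => if j \in supp w then neg w j else true].
Definition flip w (i : 'I_d) : {ffun 'I_d -> bool} :=
  [ffun j => if j == i then false else base w j].

Lemma base_mem w : (k <= #|supp w|)%N -> inr (base w) \in code_vertices w.
Proof.
move=> kw; rewrite inE kw; apply/forallP => j; apply/implyP => jw.
by rewrite ffunE jw.
Qed.

Lemma flip_mem w i : (k <= #|supp w|)%N -> i \notin supp w ->
  inr (flip w i) \in code_vertices w.
Proof.
move=> kw iw; rewrite inE kw; apply/forallP => j; apply/implyP => jw.
rewrite !ffunE jw; case: (eqVneq j i) => // ji.
by rewrite -ji jw in iw.
Qed.

Lemma top_mem w j : j \in top w -> inl (j, neg w j) \in code_vertices w.
Proof. by move=> jt; rewrite inE jt eqxx. Qed.

Definition simplex_code w := (#|top w| == #|supp w|) && (0 < #|supp w| < k)%N.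
(** Cubes ([top w] empty) and mixed faces are treated together. *)
Definition proper_code w := (#|top w| < k < #|supp w|)%N.
Definition facet_code w := (#|top w| == k) && (#|supp w| == k).

(** The vertices [inl] give the top and its signs. The presence of vertices [inr] tells proper codes
    from simplices, and their constant coordinates then give the support and the other signs. *)
Lemma code_vertices_inj w w' :
  simplex_code w || proper_code w -> simplex_code w' || proper_code w' ->
  code_vertices w = code_vertices w' -> w = w'.
Proof.
move=> cw cw' e.
have top_eq : top w = top w'.
  suff tt u u' : code_vertices u = code_vertices u' -> top u \subset top u'.
    by apply/eqP; rewrite eqEsubset !tt.
  move=> {}e; apply/subsetP => j /top_mem; rewrite e inE.
  by case/andP.
have neg_top j : j \in top w -> neg w j = neg w' j.
  by move=> /top_mem; rewrite e inE => /andP[_ /eqP].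
have big u u' : code_vertices u = code_vertices u' -> (k <= #|supp u|)%N ->
    (k <= #|supp u'|)%N.
  by move=> {}e /base_mem; rewrite e inE => /andP[].
have small u : simplex_code u || proper_code u -> (k <= #|supp u|)%N = false ->
    supp u = top u.
  move=> /orP[/andP[/eqP tu _]|/andP[_ ku]]; last by rewrite ltnW.
  by move=> _; apply/eqP; rewrite eq_sym eqEcard top_sub_supp tu leqnn.
have [kw|kw] := boolP (k <= #|supp w|)%N; last first.
  have kw' : (k <= #|supp w'|)%N = false.
    by apply/negbTE; apply: contra kw; exact: big (esym e).
  have sw := small _ cw (negbTE kw); have sw' := small _ cw' kw'.
  by apply: code_eq; rewrite ?sw ?sw'.
have kw' := big _ _ e kw.
(* At a [j] in [supp u'] but not in [supp u], [base u] and [flip u j] would both have to agree with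
   [neg u' j]. *)
have sub u u' : code_vertices u = code_vertices u' -> (k <= #|supp u|)%N ->
    {in supp u', forall j, j \in supp u /\ neg u j = neg u' j}.
  move=> {}e ku j ju'.
  have := base_mem ku; rewrite e inE => /andP[_ /forallP/(_ j)].
  rewrite ju' ffunE; case: ifP => [_ /eqP//|/negbT ju /=].
  rewrite eq_sym => /eqP n1.
  have := flip_mem ku ju; rewrite e inE => /andP[_ /forallP/(_ j)].
  by rewrite ju' ffunE eqxx n1.
apply: code_eq => //.
- apply/eqP; rewrite eqEsubset; apply/andP; split; apply/subsetP => j js.
    by have [] := sub _ _ (esym e) kw' j js.
  by have [] := sub _ _ e kw j js.
- by move=> j js; have [] := sub _ _ (esym e) kw' j js.
Qed.

End Codes.

(** * From functionals to codes and back *)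

Section FaceCodes.
Local Open Scope set_scope.
Context {R : realType} {d : nat} (k : nat).
Context (k_gt0 : (0 < k)%N).
Local Notation E := 'rV[R]_d.
Local Notation pt := (@vertex_pt R d k).
Implicit Types (c : E) (w : @code d).

Let k0 : 0 < k%:R :> R. Proof. by rewrite ltr0n. Qed.

Lemma tight_code_vertices c m w : 0 < m -> (forall j, `|c 0 j| <= m) ->
  norm1 c <= k%:R * m ->
  (forall j, (j \in top w) = (`|c 0 j| == m)) ->
  (forall j, j \in supp w -> neg w j = (c 0 j < 0)) ->
  ((k <= #|supp w|)%N = (norm1 c == k%:R * m)) ->
  ((k <= #|supp w|)%N -> forall j, (j \in supp w) = (c 0 j != 0)) ->
  [set v | dot c (pt v) == m]%SET = code_vertices k w.
Proof.
move=> m0 cm c1 topw negw kw suppw; apply/setP => -[[j b]|u]; rewrite !inE.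
  rewrite tight_inl//; have tj := topw j; rewrite inE in tj.
  rewrite -tj; case: (boolP (oapp _ _ _)) => //= jt.
  rewrite negw//; apply: (subsetP (top_sub_supp w)).
  by rewrite inE.
rewrite (tight_inr k_gt0)// -kw; case: (boolP (k <= _)%N) => //= {}kw.
apply: eq_forallb => j; rewrite -suppw//.
by case: (boolP (_ \in _)) => //= /negw ->.
Qed.

Lemma vertices_code c m : c != 0 -> (forall v, dot c (pt v) <= m) ->
  (exists v, dot c (pt v) = m) ->
  exists2 w, [|| simplex_code k w, proper_code k w | facet_code k w] &
    [set v | dot c (pt v) == m]%SET = code_vertices k w.
Proof.
move=> c0 cm [v0 v0m]; have [cj c1] := le_vertex k_gt0 cm.
have m0 : 0 < m.
  have [j cj0] : exists j, c 0 j != 0.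
    apply/existsP; apply: contraNT c0 => /existsPn c0; apply/eqP/rowP => j.
    by apply/eqP; have := c0 j; rewrite negbK mxE.
  by rewrite (lt_le_trans _ (cj j))// normr_gt0.
have [L|L] := eqVneq (norm1 c) (k%:R * m).
  pose w : code := [ffun j => if c 0 j == 0 then None
                              else Some (c 0 j < 0, `|c 0 j| == m)].
  have topw j : (j \in top w) = (`|c 0 j| == m).
    rewrite inE ffunE; case: eqP => //= ->.
    by rewrite normr0 eq_sym gt_eqF.
  have suppw j : (j \in supp w) = (c 0 j != 0).
    by rewrite inE ffunE; case: eqP.
  have L1 : norm1 c = \sum_(j in supp w) `|c 0 j|.
    rewrite /norm1 [RHS]big_mkcond; apply: eq_bigr => j _.
    by rewrite suppw; case: eqP => //= ->; rewrite normr0.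
  (* In a tie, with [n] and [t] the sizes of support and top, [(n - k) m] is the sum of the gaps
     [m - |c_j|], and by [L3] [(k - t) m] is the sum of the moduli off the top. Either [N = T] and
     [t = n = k], or both sums are positive and [t < k < n]. *)
  have L2 : (#|supp w|%:R - k%:R) * m = \sum_(j in supp w) (m - `|c 0 j|).
    by rewrite sumrB sumr_const -L1 L -mulr_natl; ring.
  have L3 : norm1 c = #|top w|%:R * m + \sum_(j in supp w :\: top w) `|c 0 j|.
    rewrite L1 (big_setID (top w))/=; congr (_ + _).
    rewrite (setIidPr (top_sub_supp w)).
    rewrite (eq_bigr (fun=> m)) ?sumr_const ?mulr_natl// => j.
    by rewrite topw => /eqP.
  have kn : (k <= #|supp w|)%N.
    rewrite -(ler_nat R) -subr_ge0 -(pmulr_lge0 _ m0) L2.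
    by apply: sumr_ge0 => j _; rewrite subr_ge0.
  exists w; last first.
    apply: tight_code_vertices => // [j|]; last by rewrite L eqxx.
    by rewrite suppw /neg ffunE; case: eqP.
  have [D0|[j jD]] := set_0Vmem (supp w :\: top w).
    have st : top w = supp w.
      by apply/eqP; rewrite eqEsubset top_sub_supp -setD_eq0 D0 eqxx.
    move: L3; rewrite D0 big_set0 addr0 L => /(mulIf (lt0r_neq0 m0))/eqP.
    rewrite eqr_nat /facet_code -st => /eqP <-.
    by rewrite eqxx !orbT.
  have /[!inE] := jD => /andP[jt js].
  rewrite /proper_code; apply/or3P/Or32/andP; split.
    rewrite -(ltr_nat R) -(ltr_pM2r m0) -L L3 ltrDl (bigD1 j)//=.
    rewrite ltr_pwDl ?sumr_ge0// normr_gt0 -suppw.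
    by rewrite inE.
  rewrite -(ltr_nat R) -subr_gt0 -(pmulr_lgt0 _ m0) L2 (bigD1 j)/=; last first.
    by rewrite inE.
  rewrite ltr_pwDl ?sumr_ge0//.
    by rewrite subr_gt0 lt_neqAle cj andbT -topw inE.
  by move=> l _; rewrite subr_ge0.
pose w : code := [ffun j => if `|c 0 j| == m then Some (c 0 j < 0, true)
                            else None].
have topw j : (j \in top w) = (`|c 0 j| == m) by rewrite inE ffunE; case: eqP.
have st : supp w = top w by apply/setP => j; rewrite !inE ffunE; case: eqP.
have kt : (#|top w| < k)%N.
  rewrite -(ltr_nat R) -(ltr_pM2r m0).
  apply: (@le_lt_trans _ _ (norm1 c)); last by rewrite lt_neqAle L.
  rewrite /norm1 (bigID (mem (top w)))/= (eq_bigr (fun=> m)) => [|j].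
    by rewrite sumr_const mulr_natl lerDl sumr_ge0.
  by rewrite topw => /eqP.
exists w.
  apply/or3P/Or31; rewrite /simplex_code st eqxx kt andbT /=.
  (* No cube vertex is tight here, so the tight vertex [v0] is of the form [inl (j, b)] and puts [j]
     in the top. *)
  apply/card_gt0P; case: v0 v0m => [[j b]|u] /eqP.
    by rewrite tight_inl// -topw => /andP[? _]; exists j.
  by rewrite (tight_inr k_gt0)// (negPf L).
apply: tight_code_vertices => // [j||].
- by rewrite inE /neg ffunE; case: eqP.
- by rewrite st leqNgt kt (negPf L).
- by rewrite st leqNgt kt.
Qed.

(** Take modulus 1 on the top, [al] on the rest of the support and 0 elsewhere. For a proper code
    [t < k < n] gives [0 < al < 1], so the three levels stay distinct. *)
Lemma code_functional w : simplex_code k w || proper_code k w ->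
  exists c, (forall v, dot c (pt v) <= 1) /\
    [set v | dot c (pt v) == 1]%SET = code_vertices k w.
Proof.
move=> cw.
(* Chosen so that [norm1 c = k] in the proper case; it is [0] and unused for
   simplices. *)
pose al : R := (k%:R - #|top w|%:R) / (#|supp w|%:R - #|top w|%:R).
pose c : E := \row_j if w j is Some (b, t) then
                       (-1) ^+ b * (if t then 1 else al) else 0.
have al01 j : j \in supp w :\: top w -> 0 < al < 1.
  move=> jD; have /andP[tk kn] : proper_code k w.
    case/orP: cw => // /andP[/eqP e _]; move: jD.
    suff -> : supp w :\: top w = set0 by rewrite inE.
    apply/eqP; rewrite setD_eq0.
    by rewrite -(geq_leqif (subset_leqif_card (top_sub_supp w))) e.
  move: tk kn; rewrite -!(ltr_nat R) => tk kn.
  by rewrite /al divr_gt0 ?ltr_pdivrMr ?mul1r; lra.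
have cE j : `|c 0 j| = if j \in top w then 1
                       else if j \in supp w then al else 0.
  have := al01 j; rewrite !inE mxE.
  case: (w j) => [[b t]|] /=; last by rewrite normr0.
  rewrite normrM normr_sign mul1r; case: t => /=; first by rewrite normr1.
  by move=> /(_ isT)/andP[al0 _]; rewrite gtr0_norm.
have c1 j : `|c 0 j| <= 1.
  rewrite cE; have := al01 j; rewrite inE.
  case: (j \in top w) => //=; case: (j \in supp w) => //= /(_ isT)/andP[_].
  exact: ltW.
have sc : norm1 c = #|top w|%:R + (#|supp w|%:R - #|top w|%:R) * al.
  have -> : #|supp w|%:R - #|top w|%:R = #|supp w :\: top w|%:R :> R.
    rewrite cardsD (setIidPr (top_sub_supp w)) natrB//.
    by rewrite subset_leq_card// top_sub_supp.
  rewrite mulr_natl -!sumr_const /norm1 (bigID (mem (top w)))/=; congr (_ + _).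
    by apply: eq_bigr => j jt; rewrite cE jt.
  rewrite (bigID (mem (supp w)))/= [X in _ + X]big1 ?addr0 => [|j /andP[jt js]].
    apply: eq_big => [j|j /andP[jt js]]; first by rewrite in_setD.
    by rewrite cE (negPf jt) js.
  by rewrite cE (negPf jt) (negPf js).
have kE : norm1 c <= k%:R /\ (k <= #|supp w|)%N = (norm1 c == k%:R).
  case/orP: cw => /andP[].
    move=> /eqP tn /andP[n0 nk].
    rewrite sc tn subrr mul0r addr0 ler_nat eqr_nat.
    by split; lia.
  move=> tk kn; rewrite sc /al mulrC divfK.
    by rewrite addrC subrK eqxx ltnW.
  by rewrite subr_eq0 eqr_nat; lia.
exists c; split; first by apply: (vertex_le k_gt0); rewrite ?mulr1; case: kE.
apply: tight_code_vertices => //; rewrite ?mulr1; try by case: kE.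
- move=> j; rewrite cE.
  case: (boolP (j \in top w)) => jt; first by rewrite eqxx.
  have := al01 j; rewrite inE jt /=.
  case: (j \in supp w) => [/(_ isT)/andP[_ a1]|_].
    by rewrite lt_eqF.
  by rewrite eq_sym oner_eq0.
- move=> j js; have := al01 j; move: js; rewrite !inE mxE /neg.
  case: (w j) => [[b t]|] //= _ h.
  have t0 : 0 < (if t then 1 else al) by case: t h => //= /(_ isT)/andP[].
  by case: b; rewrite ?expr1 ?expr0 ?mulN1r ?mul1r ?oppr_lt0 ?t0// ltNge ltW.
- move=> _ j; rewrite -normr_eq0 cE; have := al01 j; rewrite inE.
  have := subsetP (top_sub_supp w) j.
  case: (j \in top w) => /= [-> //|_]; first by rewrite oner_eq0.
  case: (j \in supp w) => [/(_ isT)/andP[a0 _]|_]; last by rewrite eqxx.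
  by rewrite gt_eqF.
Qed.

End FaceCodes.

(** * Dimension *)

Section FaceDimension.
Local Open Scope set_scope.
Context {R : realType} {d : nat} (k : nat).
Context (k_gt0 : (0 < k)%N).
Local Notation E := 'rV[R]_d.
Local Notation pt := (@vertex_pt R d k).
Implicit Types (w : @code d) (I T : {set 'I_d}).

(* The coordinate [j1] outside [I] sees only the multiples of [x0], so that their
   coefficients add up to [0]; the others are then read off coordinatewise. *)
Lemma frame_indep I (g : 'I_d -> R) (e : 'I_d -> bool) (x0 : E) j1 :
  j1 \notin I -> x0 0 j1 != 0 -> {in I, forall j, g j != 0} ->
  forall a : 'I_d -> R,
  \sum_(j in I) a j *: (g j *: delta_mx 0 j - (e j)%:R *: x0) = 0 ->
  forall j, j \in I -> a j = 0.
Proof.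
move=> j1I x1 g0 a s0; pose s := \sum_(j in I) a j * (e j)%:R.
have coordE l : (if l \in I then a l * g l else 0) = s * x0 0 l.
  apply/eqP; rewrite -subr_eq0; apply/eqP.
  have := congr1 (fun x : E => x 0 l) s0; rewrite mxE summxE => s0l.
  rewrite -[RHS]s0l.
  under [RHS]eq_bigr do rewrite !mxE mulrBr mulrA.
  rewrite sumrB mulr_suml; congr (_ - _); last first.
    by apply: eq_bigr => j _; rewrite mulrA.
  rewrite /=; case: ifP => lI; last first.
    rewrite big1// => j jI; case: eqP => [lj|]; last by rewrite !mulr0.
    by rewrite lj jI in lI.
  rewrite (bigD1 l)//= eqxx mulr1 big1 ?addr0// => j /andP[_ jl].
  by rewrite eq_sym (negPf jl) mulr0.
have s00 : s = 0.
  have /esym/eqP := coordE j1; rewrite (negPf j1I) mulf_eq0 (negPf x1) orbF.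
  by move/eqP.
move=> j jI; have /eqP := coordE j.
by rewrite jI s00 mul0r mulf_eq0 (negPf (g0 j jI)) orbF => /eqP.
Qed.

(** The directions go from one vertex to the others; coordinate [j0] sees only [x0], which yields
    their independence. *)
Lemma has_dim_simplex w i : simplex_code k w -> #|supp w| = i.+1 ->
  has_dim (hull pt (code_vertices k w)) i.
Proof.
move=> /andP[/eqP tn /andP[n0 nk]] ni.
have [j0 j0t] : exists j, j \in top w by apply/card_gt0P; rewrite tn.
pose x0 : E := pt (inl (j0, neg w j0)).
pose b j : E := (-1) ^+ neg w j *: delta_mx 0 j - (true)%:R *: x0.
have bE j : x0 + b j = pt (inl (j, neg w j)).
  by rewrite /b scale1r addrC subrK.
have indep := @frame_indep (top w :\ j0) (fun j => (-1) ^+ neg w j)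
  (fun=> true) x0 j0.
have -> : i = #|top w :\ j0|.
  by move: (cardsD1 j0 (top w)); rewrite j0t tn ni => -[].
apply: (@has_dim_frame _ _ _ x0 b).
- apply: indep => [||j _].
  + by rewrite !inE eqxx.
  + by rewrite !mxE !eqxx mulr1 signr_eq0.
  + by rewrite signr_eq0.
- by apply: hull_vertex; apply: top_mem.
- move=> j; rewrite in_setD1 => /andP[_ jt]; rewrite bE.
  by apply: hull_vertex; apply: top_mem.
- apply: hull_subspace => -[[j c]|u]; rewrite inE; last by rewrite leqNgt nk.
  move=> /andP[jt /eqP->]; have [->|jj0] := eqVneq j j0.
    by rewrite subrr mem0v.
  have -> : pt (inl (j, neg w j)) - x0 = b j by rewrite /b scale1r.
  by apply/memv_span/mem_frame; rewrite in_setD1 jj0.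
Qed.

Section BaseFrame.
Context (w : @code d).
Let x0 : E := pt (inr (base w)).
(** From the cube vertex [base w], these directions lead to a vertex [inl] for [j] in the support,
    and along an edge of the cube otherwise. *)
Let b (j : 'I_d) : E :=
  (if j \in supp w then (-1) ^+ neg w j else 2 / k%:R) *: delta_mx 0 j
  - (j \in supp w)%:R *: x0.

Let k0 : k%:R != 0 :> R. Proof. by rewrite pnatr_eq0 -lt0n. Qed.

Lemma base_frame_supp j : j \in supp w -> x0 + b j = pt (inl (j, neg w j)).
Proof. by move=> js; rewrite /b js scale1r addrC subrK. Qed.

Lemma base_frame_flip j : j \notin supp w -> x0 + b j = pt (inr (flip w j)).
Proof.
move=> js; rewrite /b (negPf js) scale0r subr0.
apply/rowP => l; rewrite !mxE !ffunE.
case: (eqVneq l j) => [->|]; last by rewrite mulr0 addr0.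
by rewrite (negPf js) /= expr1 expr0; field.
Qed.

Lemma base_frame_indep I j1 : j1 \notin I -> forall a : 'I_d -> R,
  \sum_(j in I) a j *: b j = 0 -> forall j, j \in I -> a j = 0.
Proof.
move=> j1I; apply: (frame_indep (j1 := j1)) => //.
  by rewrite !mxE mulf_eq0 invr_eq0 (negPf k0) signr_eq0.
move=> j _; case: ifP => _; first by rewrite signr_eq0.
by rewrite mulf_neq0// ?invr_eq0// pnatr_eq0.
Qed.

Lemma has_dim_proper : proper_code k w ->
  has_dim (hull pt (code_vertices k w)) #|~: supp w :|: top w|.
Proof.
move=> /andP[tk kn].
have [j1 j1s j1t] : exists2 j1, j1 \in supp w & j1 \notin top w.
  have /subsetPn : ~~ (supp w \subset top w); last by [].
  by apply: contraL (ltn_trans tk kn) => /subset_leq_card; rewrite leqNgt.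
apply: (@has_dim_frame _ _ _ x0 b).
- by apply: (base_frame_indep (j1 := j1)); rewrite in_setU in_setC j1s.
- by apply/hull_vertex/base_mem/ltnW.
- move=> j; rewrite in_setU in_setC => /orP[js|jt].
    by rewrite base_frame_flip//; apply/hull_vertex/flip_mem => //; exact: ltnW.
  rewrite base_frame_supp; first exact/hull_vertex/top_mem.
  exact: subsetP (top_sub_supp w) _ jt.
- apply: hull_subspace => -[[j c]|u]; rewrite inE.
    move=> /andP[jt /eqP->].
    have js := subsetP (top_sub_supp w) _ jt.
    have -> : pt (inl (j, neg w j)) - x0 = b j by rewrite /b js scale1r.
    by apply/memv_span/mem_frame; rewrite in_setU jt orbT.
  move=> /andP[_ /forallP us].
  (* [u] differs from [base w] only off the support; the coefficient is 1 where it does and 0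
     elsewhere. *)
  have -> : pt (inr u) - x0 =
      \sum_(j in ~: supp w) (((-1) ^+ u j + 1) / 2) *: b j.
    apply/rowP => l; rewrite !mxE summxE.
    transitivity
      (\sum_(j in ~: supp w) ((-1) ^+ u j + 1) / k%:R * (l == j)%:R : R).
      case: (boolP (l \in supp w)) => ls.
        rewrite big1 => [|j]; last first.
          rewrite in_setC; case: eqP => [<-|_ _]; first by rewrite ls.
          by rewrite mulr0.
        by have := us l; rewrite !ffunE ls /= => /eqP->; rewrite subrr.
      rewrite (bigD1 l) ?in_setC//= big1 ?addr0 => [|j /andP[_ jl]].
        by rewrite ffunE (negPf ls) eqxx /= expr1; field.
      by rewrite eq_sym (negPf jl) mulr0.
    apply: eq_bigr => j; rewrite in_setC => js.
    by rewrite /b (negPf js) scale0r subr0 !mxE /=; field.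
  apply: memv_suml => j js; apply/memvZ/memv_span/mem_frame.
  by rewrite in_setU js.
Qed.

(** A lower bound, enough to discard the facets and the whole polytope. The coordinate [j1] is kept
    out of the frame to ensure independence. *)
Lemma leq_dim (A : set E) T j1 i : (k <= #|supp w|)%N ->
  (hull pt (code_vertices k w) `<=` A)%classic -> has_dim A i ->
  T \subset top w -> j1 \in supp w -> j1 \notin T ->
  (#|~: supp w :|: T| <= i)%N.
Proof.
move=> kn sA dA Tt j1s j1T.
apply: (@leq_has_dim _ _ _ x0 b _ A) => //.
- by apply: (base_frame_indep (j1 := j1)); rewrite in_setU in_setC j1s.
- by apply/sA/hull_vertex/base_mem.
- move=> j; rewrite in_setU in_setC => /orP[js|/(subsetP Tt) jt].
    by rewrite base_frame_flip//; apply/sA/hull_vertex/flip_mem.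
  rewrite base_frame_supp; first exact/sA/hull_vertex/top_mem.
  exact: subsetP (top_sub_supp w) _ jt.
Qed.

End BaseFrame.

Lemma card_proper w : (#|~: supp w :|: top w| + #|supp w| = d + #|top w|)%N.
Proof.
have : [disjoint ~: supp w & top w].
  by rewrite -setI_eq0 setIC -setDE setD_eq0 top_sub_supp.
rewrite -leq_card_setU => /eqP ->.
by move: (cardsC (supp w)); rewrite card_ord; lia.
Qed.

(** Here [top w = supp w], so one coordinate is dropped from the top; the [d - 1] others remain as
    directions. *)
Lemma facet_dim w i : facet_code k w ->
  has_dim (hull pt (code_vertices k w)) i -> (d.-1 <= i)%N.
Proof.
move=> /andP[/eqP tk /eqP nk] di.
have st : top w = supp w.
  by apply/eqP; rewrite eqEcard top_sub_supp tk nk leqnn.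
have [j1 j1s] : exists j, j \in supp w by apply/card_gt0P; rewrite nk.
have le := @leq_dim w _ (top w :\ j1) j1 i _ _ di.
rewrite (leq_trans _ (le _ _ _ _ _)) ?nk ?subD1set//; last by rewrite !inE eqxx.
have -> : ~: supp w :|: top w :\ j1 = [set~ j1].
  rewrite st; apply/setP => j; rewrite !inE.
  case: (eqVneq j j1) => [->|_] /=; last by rewrite orNb.
  by rewrite inE in j1s; rewrite j1s.
by rewrite cardsC1 card_ord.
Qed.

Lemma rho_dim i : (k < d)%N -> has_dim (rho d (k%:R : R)) i -> (d.-1 <= i)%N.
Proof.
move=> kd di; pose j1 := Ordinal (leq_ltn_trans (leq0n k) kd).
(* This code is of none of the three kinds; it only selects enough vertices of the polytope for
   [d - 1] independent directions. *)
pose w : @code d := [ffun j => Some (false, j != j1)].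
have ws : supp w = [set: 'I_d] by apply/setP => j; rewrite !inE ffunE.
have wt : top w = [set~ j1] by apply/setP => j; rewrite !inE ffunE.
have := @leq_dim w _ (top w) j1 i _ _ di (subxx _).
rewrite wt ws setCT set0U cardsC1 cardsT card_ord; apply.
- exact: ltnW.
- rewrite rho_hull//; apply: hull_min; first exact: convex_hull.
  by move=> v; apply: hull_vertex; rewrite inE.
- by rewrite inE.
- by rewrite !inE eqxx.
Qed.

(** The equation says [i = d - n + t] without truncated subtraction. Facet codes are left out, as
    [i < d - 1] in what follows. *)
Definition face_codes i : {set @code d} :=
  [set w | simplex_code k w && (#|supp w| == i.+1)
        || proper_code k w && (d + #|top w| == #|supp w| + i)%N].

Definition code_face w : set E := hull pt (code_vertices k w).

Lemma faces_rho i : (i < d.-1)%N -> (k < d)%N ->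
  faces i (rho d (k%:R : R)) = (code_face @` [set` face_codes i])%classic.
Proof.
move=> ltid kd; apply/seteqP; split=> [F [[c [m [cm FE]]] dF]|_ [w wi <-]].
  have [x Fx] := has_dim_nonempty dF.
  have {}cm v : dot c (pt v) <= m.
    by apply: cm; rewrite rho_hull//; apply: hull_vertex; rewrite inE.
  (* The zero functional exposes only the whole polytope, of too large a dimension, and the empty
     set, which has none. *)
  have [c0|c0] := eqVneq c 0.
    have dot0 y : dot c y = 0.
      by rewrite c0 /dot big1// => j _; rewrite mxE mul0r.
    have [m0|m0] := eqVneq m 0.
      suff e : F = rho d k%:R.
        by move: dF; rewrite e => /(rho_dim kd); rewrite leqNgt ltid.
      by rewrite FE m0; apply/seteqP; split=> y //= [].
    move: Fx; rewrite FE => -[_ /=]; rewrite dot0 => m0'.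
    by rewrite m0' eqxx in m0.
  have FH : F = hull pt [set v | dot c (pt v) == m].
    by rewrite FE rho_hull// hull_face.
  have ne : exists v, dot c (pt v) = m.
    move: Fx; rewrite FH => -[a [_ aS a1 _]].
    have [v vS] : exists v, v \in [set v | dot c (pt v) == m].
      apply/existsP; apply: contraT => /existsPn nS; move: a1; rewrite big1.
        by move/eqP; rewrite eq_sym oner_eq0.
      by move=> v _; apply: aS.
    by exists v; move: vS; rewrite inE => /eqP.
  have [w cw Sw] := vertices_code k_gt0 c0 cm ne.
  exists w; last by rewrite FH Sw.
  move: dF; rewrite FH Sw => dF; rewrite /= inE.
  case/or3P: cw => cw.
  - rewrite cw /=; have /andP[_ /andP[n0 _]] := cw.
    have := has_dim_simplex cw (esym (prednK n0)).
    by move=> /(has_dim_inj dF) ->; rewrite prednK// eqxx.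
  - rewrite cw /= -card_proper (has_dim_inj dF (has_dim_proper cw)).
    by rewrite addnC eqxx orbT.
  - by have := facet_dim cw dF; rewrite leqNgt ltid.
have cw : simplex_code k w || proper_code k w.
  by move: wi; rewrite /= inE => /orP[] /andP[-> _]; rewrite ?orbT.
have [c [cm cE]] := @code_functional R d k k_gt0 _ cw.
split.
  exists c, 1; rewrite rho_hull//; split=> [x|].
    by apply: dot_hull_le.
  by rewrite /code_face -cE hull_face.
move: wi; rewrite /= inE => /orP[] /andP[{}cw /eqP e].
  exact: has_dim_simplex cw e.
have -> : i = #|~: supp w :|: top w|.
  by have := card_proper w; lia.
exact: has_dim_proper.
Qed.

Lemma code_face_inj i : {in face_codes i &, injective code_face}.
Proof.
have valid w : w \in face_codes i -> simplex_code k w || proper_code k w.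
  by rewrite inE => /orP[] /andP[-> _]; rewrite ?orbT.
move=> w w' /valid cw /valid cw' e; apply: (code_vertices_inj cw cw').
have [c [cm cE]] := @code_functional R d k k_gt0 _ cw.
have [c' [cm' cE']] := @code_functional R d k k_gt0 _ cw'.
move: e; rewrite /code_face -cE -cE' => e; apply/setP => v; rewrite !inE.
have [h1 h2] := hull_face_vertex v cm.
have [h3 h4] := hull_face_vertex v cm'.
apply/idP/idP => h; first by apply: h3; rewrite -e; apply: h2.
by apply: h1; rewrite e; apply: h4.
Qed.

Lemma num_faces_rho i : (i < d.-1)%N -> (k < d)%N ->
  finite_set (faces i (rho d (k%:R : R))) /\
  num_faces i (rho d (k%:R : R)) = #|face_codes i|.
Proof.
move=> ltid kd; rewrite /num_faces faces_rho//.
have finW : finite_set [set` face_codes i] by exact: finite_finset.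
have finF : finite_set (code_face @` [set` face_codes i])%classic.
  exact: finite_image.
split=> //.
(* Injectivity of [code_face] reduces the count of faces to that of codes. *)
have -> : #|` fset_set (code_face @` [set` face_codes i])%classic| =
          #|` fset_set [set` face_codes i]|.
  apply/(fcard_eq finF finW); apply: inj_card_eq => w w'.
  by rewrite !classical_sets.in_setE; apply: code_face_inj.
rewrite -(card_finset (mem (face_codes i))); congr #|` _|.
apply/fsetP => w; rewrite in_fset_set// inE.
apply/idP/idP => [/classical_sets.set_mem//|h].
exact/classical_sets.mem_set.
Qed.

End FaceDimension.

(** * Counting *)

Section Count.
Local Open Scope set_scope.
Context {d : nat}.
Implicit Types (w : @code d) (N T S : {set 'I_d}).

(** [S] collects the negative coordinates; once [N] and [T] are fixed, codes correspond to the
    subsets [S] of [N]. *)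
Definition mk_code N T S : @code d :=
  [ffun j => if j \in N then Some (j \in S, j \in T) else None].

Lemma card_code_supp_top N T : T \subset N ->
  #|[set w : @code d | (supp w == N) && (top w == T)]| = (2 ^ #|N|)%N.
Proof.
move=> TN; rewrite -card_powerset.
rewrite -(card_in_imset (f := mk_code N T)); last first.
  move=> S S'; rewrite !inE => SN SN' /ffunP e; apply/setP => j.
  have := e j; rewrite !ffunE; case: ifP => [_ [] //|/negbT jN _].
  rewrite (negbTE (contra (subsetP SN j) jN)).
  by rewrite (negbTE (contra (subsetP SN' j) jN)).
apply: eq_card => w; rewrite inE.
apply/andP/imsetP => [[/eqP sw /eqP tw]|[S SN ->]].
  exists [set j in N | neg w j].
    by rewrite inE; apply/subsetP => j; rewrite inE => /andP[].
  apply/ffunP => j; rewrite ffunE -sw -tw !inE /neg.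
  by case: (w j) => [[b t]|].
split; apply/eqP/setP => j; rewrite inE ffunE; first by case: ifP.
case: ifP => //= jN; apply/esym/negbTE.
by apply: contraFN jN => /(subsetP TN).
Qed.

Lemma card_codes n t :
  #|[set w : @code d | (#|supp w| == n) && (#|top w| == t)]| =
  ('C(d, n) * 'C(n, t) * 2 ^ n)%N.
Proof.
rewrite -sum1_card (partition_big (@supp d) (fun N => #|N| == n)); last first.
  by move=> w; rewrite inE => /andP[].
rewrite (eq_bigr (fun=> ('C(n, t) * 2 ^ n)%N)) => [|N /eqP Nn].
  rewrite sum_nat_const mulnA; congr (_ * _ * _)%N.
  rewrite -[in RHS](card_ord d) -card_draws.
  by apply: eq_card => N; rewrite inE.
rewrite (partition_big (@top d)
          (fun T => (T \subset N) && (#|T| == t))); last first.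
  move=> w; rewrite inE => /andP[/andP[_ ->] /eqP <-].
  by rewrite top_sub_supp.
rewrite (eq_bigr (fun=> (2 ^ n)%N)) => [|T /andP[TN /eqP Tt]].
  rewrite sum_nat_const; congr (_ * _)%N.
  by rewrite -Nn -cards_draws; apply: eq_card => T; rewrite inE.
rewrite -{2}Nn -(card_code_supp_top TN) -[RHS]sum1_card; apply: eq_bigl => w.
rewrite !inE; case: (eqVneq (supp w) N) => [->|]; last by rewrite andbF.
by case: (eqVneq (top w) T) => [->|]; rewrite ?andbF// Nn Tt !eqxx.
Qed.

(** The first term counts simplices. In the sum, [j = d - n] and [t = i - j], so [t < k < n] becomes
    [i < j + k] and [j + k < d]. *)
Lemma card_face_codes k i : (i <= d)%N ->
  #|face_codes (d := d) k i| =
  ((i.+1 < k) * (2 ^ i.+1 * 'C(d, i.+1)) +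
   \sum_(0 <= j < i.+1 | (i < j + k) && (j + k < d))
     2 ^ (d - j) * ('C(d, d - j) * 'C(d - j, i - j)))%N.
Proof.
move=> led.
pose A := [set w : @code d | simplex_code k w && (#|supp w| == i.+1)].
pose B := [set w : @code d | proper_code k w &&
                             (d + #|top w| == #|supp w| + i)%N].
have -> : face_codes k i = A :|: B by apply/setP => w; rewrite !inE.
rewrite cardsU.
have -> : A :&: B = set0.
  apply/setP => w; rewrite !inE; apply/negbTE/negP.
  by rewrite /simplex_code /proper_code; lia.
rewrite cards0 subn0; congr addn.
  have [ik|ik] := boolP (i.+1 < k)%N.
    have -> : A = [set w : @code d | (#|supp w| == i.+1) && (#|top w| == i.+1)].
      by apply/setP => w; rewrite !inE /simplex_code; lia.
    by rewrite card_codes binn; lia.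
  rewrite mul0n; apply/eqP; rewrite cards_eq0; apply/eqP/setP => w.
  by rewrite !inE /simplex_code; lia.
have supp_le w : (#|supp w| <= d)%N.
  by rewrite -[X in (_ <= X)%N](card_ord d) max_card.
have inB (w : @code d) : w \in B <->
    [/\ (#|top w| < k)%N, (k < #|supp w|)%N & (d + #|top w| = #|supp w| + i)%N].
  rewrite inE; split=> [/andP[/andP[? ?] /eqP ?] //|[? ? /eqP ?]].
  by apply/andP; split=> //; apply/andP.
rewrite big_mkord -sum1_card.
(* On [B], [d - n = i - t] is at most [i], so [inord] keeps its value. *)
rewrite (partition_big (fun w => inord (d - #|supp w|) : 'I_i.+1)
          (fun j : 'I_i.+1 => (i < j + k)%N && (j + k < d)%N)); last first.
  move=> w /inB[tk kn e]; have := supp_le w => h1.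
  by rewrite inordK; lia.
apply: eq_bigr => j /andP[j1 j2].
rewrite mulnC -card_codes -sum1_card; apply: eq_bigl => w.
have := supp_le w; have := ltn_ord j => jl h1.
apply/andP/idP => [[/inB[tk kn e] /eqP je]|].
  have hb : (d - #|supp w| < i.+1)%N by lia.
  have e2 : (d - #|supp w| = j)%N.
    by move/(congr1 (@nat_of_ord _)): je; rewrite inordK.
  have h2 : #|supp w| = (d - j)%N by lia.
  have h3 : #|top w| = (i - j)%N by lia.
  by rewrite inE; apply/andP; split; exact/eqP.
rewrite inE => /andP[/eqP h2 /eqP h3]; split; first by apply/inB; split; lia.
have hb : (d - #|supp w| < i.+1)%N by lia.
have e2 : (d - #|supp w| = j)%N by lia.
by rewrite e2 inord_val.
Qed.

End Count.

(** * Comparison with the closed formula *)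

Lemma bin_factE (m n : nat) :
  'C(m + n, m)%:R = (m + n)`!%:R / (m`!%:R * n`!%:R) :> rat.
Proof.
have := bin_fact (leq_addr n m); rewrite addKn => <-.
by rewrite natrM natrM mulfK// mulf_neq0// pnatr_eq0 -lt0n fact_gt0.
Qed.

(** Both sides equal [2^(d - j) d! / (j! (i - j)! (d - i)!)]. *)
Lemma fstar_term (d k i j : nat) :
  (j <= i)%N -> (i <= j + k)%N -> (j + k <= d)%N ->
  'C(d, k)%:R * (2 ^+ (d - j) *
    (('C(d - k, j)%:R * 'C(k, i - j)%:R) / 'C(d - i, d - k - j)%:R)) =
  (2 ^ (d - j) * ('C(d, d - j) * 'C(d - j, i - j)))%:R :> rat.
Proof.
(* In terms of [j], [a], [b] and [e] all subtractions disappear, and [field] can work on the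
   factorials. *)
move=> ji ik kd; pose a := (d - k - j)%N; pose b := (i - j)%N.
pose e := (j + k - i)%N.
have -> : d = ((b + e) + (j + a))%N by rewrite /a /b /e; lia.
have -> : k = (b + e)%N by rewrite /a /b /e; lia.
have -> : i = (j + b)%N by rewrite /a /b /e; lia.
clearbody a b e; clear.
have -> : (j + b - j)%N = b by lia.
have -> : (b + e + (j + a) - (b + e))%N = (j + a)%N by lia.
have -> : (j + a - j)%N = a by lia.
have -> : (b + e + (j + a) - (j + b))%N = (a + e)%N by lia.
have -> : (b + e + (j + a) - j)%N = (b + (a + e))%N by lia.
rewrite !natrM natrX mulrCA; congr (_ * _).
have -> : 'C(b + e + (j + a), b + (a + e)) = 'C(b + (a + e) + j, b + (a + e)).
  by congr 'C(_, _); lia.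
rewrite !bin_factE.
have -> : (b + (a + e) + j = b + e + (j + a))%N by lia.
have f0 n : n`!%:R != 0 :> rat by rewrite pnatr_eq0 -lt0n fact_gt0.
by field; rewrite !f0.
Qed.

(** The bounds of the sum turn into the conditions [i < j + k], [j + k < d] and [j < i]; the last
    one leaves out the cubes. *)
Lemma fstarE (d k i : nat) : (0 < i < d)%N -> (1 < k < d)%N ->
  fstar d k i = (\sum_(0 <= j < i | (i < j + k) && (j + k < d))
    2 ^ (d - j) * ('C(d, d - j) * 'C(d - j, i - j)))%N%:R.
Proof.
move=> hi hk; rewrite /fstar mulr_sumr natr_sum.
rewrite (big_nat_widenl _ 0)// (big_nat_widen _ _ i); last by lia.
rewrite big_nat_cond [RHS]big_nat_cond.
apply: eq_big => [j|j /andP[/andP[_ ji] jm]]; first by lia.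
by apply: fstar_term; lia.
Qed.

Theorem theorem2p6 (R : realType) (d i k : nat)
    (hi : (1 <= i < d - 1)%N) (hk : (1 < k < d)%N) :
  finite_set (faces i (rho d (k%:R : R))) /\
  let f : rat := (num_faces i (rho d (k%:R : R)))%:R in
  [/\ (maxn (d - k) (k - 1) <= i)%N -> f = fstar d k i,
      (d - k <= i < k - 1)%N ->
        f = 2 ^+ (i + 1) * 'C(d, i + 1)%:R + fstar d k i,
      (k - 1 <= i < d - k)%N ->
        f = 2 ^+ (d - i) * 'C(d, i)%:R + fstar d k i
    & (i < minn (d - k) (k - 1))%N ->
        f = 2 ^+ (i + 1) * 'C(d, i + 1)%:R
            + 2 ^+ (d - i) * 'C(d, i)%:R + fstar d k i].
Proof.
have k0 : (0 < k)%N by lia.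
have id1 : (i < d.-1)%N by lia.
have kd : (k < d)%N by lia.
have [fin card] := @num_faces_rho R d k k0 i id1 kd; split=> // f.
(* Booleans read as 0 or 1 merge the four cases: the first term counts the simplices, the second is
   the summand [j = i], counting the cubes, and [fstar] counts the mixed faces. *)
have fE : f = ((i.+1 < k)%N%:R * (2 ^+ i.+1 * 'C(d, i.+1)%:R) +
    (i + k < d)%N%:R * (2 ^+ (d - i) * 'C(d, i)%:R)) + fstar d k i.
  rewrite fstarE; [|lia..].
  rewrite /f card card_face_codes; last by lia.
  rewrite big_mkcond big_nat_recr//= -big_mkcond/= subnn bin0 muln1.
  rewrite bin_sub; last by lia.
  have -> : (i < i + k)%N by lia.
  rewrite /= !natrD natrM natrM natrX -addrA; congr (_ + _).
  rewrite addrC; congr (_ + _).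
  by case: ifP => _; rewrite ?mul0r// mul1r natrM natrX.
rewrite fE !addn1; split=> h.
- have -> : (i.+1 < k)%N = false by lia.
  have -> : (i + k < d)%N = false by lia.
  by rewrite /= !mul0r !add0r.
- have -> : (i.+1 < k)%N by lia.
  have -> : (i + k < d)%N = false by lia.
  by rewrite /= mul0r mul1r addr0.
- have -> : (i.+1 < k)%N = false by lia.
  have -> : (i + k < d)%N by lia.
  by rewrite /= mul0r mul1r add0r.
- have -> : (i.+1 < k)%N by lia.
  have -> : (i + k < d)%N by lia.
  by rewrite /= !mul1r.
Qed.
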